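(* Let $U$ be a finite ground set with $|U|=n$, $f:2^U\to\mathbb{R}_{\geq0}$ nonnegative, monotone and submodular, and $\tau$ a threshold such that some set has $f$-value at least $\tau$; let $OPT$ be a minimum-cardinality set with $f(OPT)\geq\tau$. Let $\epsilon>0$, $\alpha>0$, $\delta\in(0,1)$. Then, with probability at least $1-\delta$, the algorithm \texttt{stoch-greedy-c} (described in the context) outputs a set $S$ with $f(S)\geq(1-\epsilon)\tau$ and $|S|\leq(1+\alpha)\lceil\ln(3/\epsilon)\rceil|OPT|$, and it makes at most $O\!\left(\frac{\alpha}{1+\alpha}\,n\ln(1/\delta)\ln^2(3/\epsilon)\log_{1+\alpha}(|OPT|)\right)$ queries of $f$.
   Context: A set function $f$ is submodular if $f(A\cup\{x\})-f(A)\geq f(B\cup\{x\})-f(B)$ for all $A\subseteq B\subseteq U$, $x\notin B$, and monotone if $f(A)\leq f(B)$ whenever $A\subseteq B$. Write $f_\tau(X)=\min\{f(X),\tau\}$ and $\Delta f_\tau(S,u)=f_\tau(S\cup\{u\})-f_\tau(S)$. Queries are evaluations of $f$. Algorithm \texttt{stoch-greedy-c}(inputs $\epsilon,\alpha,\delta,\tau$): let $m=\ln(1/\delta)/\ln 2$ (treated as an integer) and set $S_1=\dots=S_m=\emptyset$, $r\gets1$, $g\gets1+\alpha$. While $f(S_i)<(1-\epsilon)\tau$ for every $i\in\{1,\dots,m\}$: for each $i=1,\dots,m$, draw (independently of all other randomness) a uniformly random subset $R\subseteq U$ of $\min\{n,\,n\ln(3/\epsilon)/g\}$ elements, let $u=\arg\max_{x\in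 R}\Delta f_\tau(S_i,x)$, and set $S_i\gets S_i\cup\{u\}$; then set $r\gets r+1$, and if $r>\ln(3/\epsilon)g$ set $g\gets(1+\alpha)g$. Finally return $\arg\min\{|S_i|: f(S_i)\geq(1-\epsilon)\tau\}$.
   Formalization: Assumes ε ≤ 1; the query bound is stated for δ ≤ 1/2, with an absolute O-constant once |OPT| ≥ k0(α) and an α-dependent constant for |OPT| ≥ 2, as a uniform O is false (|OPT| = 1 gives 0); m and sample sizes are rounded up. *)

(* Defs.v *)
From HB Require Import structures.
From mathcomp Require Import all_boot all_order all_algebra.
From mathcomp Require Import all_classical all_reals all_analysis.
Import Order.TTheory GRing.Theory Num.Theory.

Set Implicit Arguments.
Unset Strict Implicit.
Unset Printing Implicit Defensive.

Local Open Scope classical_set_scope.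
Local Open Scope ring_scope.

Section SetFunctions.
Context {R : realType} {U : finType}.
Implicit Types (f : {set U} -> R) (tau : R).

Definition submodular f :=
  forall (A B : {set U}) (x : U), A \subset B -> x \notin B ->
    f (x |: B) - f B <= f (x |: A) - f A.

Definition set_monotone f := forall A B : {set U}, A \subset B -> f A <= f B.

Definition is_opt f tau (OPT : {set U}) :=
  tau <= f OPT /\ forall A : {set U}, tau <= f A -> (#|OPT| <= #|A|)%N.

Definition truncated f tau (X : {set U}) : R := Num.min (f X) tau.

Definition gain f tau (S : {set U}) (u : U) : R :=
  truncated f tau (u |: S) - truncated f tau S.

Definition is_argmax f tau (S A : {set U}) (u : U) :=
  u \in A /\ forall x, x \in A -> gain f tau S x <= gain f tau S u.

(* [sel S A] resolves the argmax over the sample [A] at the current solution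
   [S], with an arbitrary rule for breaking ties.  It is [None] only when there
   is nothing to choose from. *)
Definition argmax_rule f tau (sel : {set U} -> {set U} -> option U) :=
  forall S A : {set U},
    if sel S A is Some u then is_argmax f tau S A u else A = finset.set0.

End SetFunctions.

Section Schedule.
Context {R : realType}.
Implicit Types (eps alpha delta : R).

Definition num_runs delta : nat := `|Num.ceil (ln delta^-1 / ln 2)|%N.

(* The guess [g] during iteration [t], where iterations are numbered from 0:
   the counter [r] equals [t.+1] during iteration [t], and it has just become
   [t.+2] when it is compared with ln(3/eps) * g at the end of iteration [t]. *)
Fixpoint guess eps alpha (t : nat) : R :=
  if t is t'.+1 then
    let g := guess eps alpha t' in
    if ln (3 / eps) * g < t'.+2%:R then (1 + alpha) * g else g
  else 1 + alpha.

(* Rounded up, so that samples of a nonempty ground set are never empty. *)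
Definition sample_size (n : nat) eps alpha (t : nat) : nat :=
  minn n `|Num.ceil (n%:R * ln (3 / eps) / guess eps alpha t)|%N.

(* Evaluations of f made when the loop stops after exactly [t] iterations,
   without any caching: [t.+1] loop tests and the final selection evaluate f on
   each of the m solutions, and every marginal gain costs two evaluations. *)
Definition num_queries (n : nat) eps alpha delta (t : nat) : nat :=
  (num_runs delta * t.+2 +
   num_runs delta * \sum_(t' < t) 2 * sample_size n eps alpha t')%N.

Definition query_bound (n k : nat) eps alpha delta : R :=
  alpha / (1 + alpha) * n%:R * ln delta^-1 * ln (3 / eps) ^+ 2 *
  (ln k%:R / ln (1 + alpha)).

End Schedule.

Section Draws.
Context {R : realType} {U : finType}.
Context {d : measure_display} {T : measurableType d} (P : probability T R).

Definition discrete_rv (X : T -> {set U}) :=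
  forall B : set {set U}, measurable (X @^-1` B).

Definition uniform_of_size (s : nat) (X : T -> {set U}) :=
  forall A : {set U},
    P (X @^-1` [set A]) = (if #|A| == s then 'C(#|U|, s)%:R^-1 else 0)%:E.

Definition mutually_independent (I : eqType) (X : I -> T -> {set U}) :=
  forall (J : seq I) (B : I -> set {set U}), uniq J ->
    P [set w | forall j, j \in J -> B j (X j w)] =
    (\prod_(j <- J) P (X j @^-1` B j))%E.

(* [draw t i] is the sample used by run [i] in iteration [t].  The sample sizes
   do not depend on the outcomes, so the samples can be given for all [t]; the
   algorithm only looks at those of the iterations it executes. *)
Definition random_samples (m : nat) (eps alpha : R)
    (draw : nat -> 'I_m -> T -> {set U}) :=
  [/\ forall t i, discrete_rv (draw t i),
      forall t i, uniform_of_size (sample_size #|U| eps alpha t) (draw t i) &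
      mutually_independent (fun j : nat * 'I_m => draw j.1 j.2)] :> Prop.

End Draws.

Section Algorithm.
Context {R : realType} {U : finType} {T : Type}.
Context (f : {set U} -> R) (tau eps alpha delta : R).
Context (sel : {set U} -> {set U} -> option U).
Context (draw : nat -> 'I_(num_runs delta) -> T -> {set U}).

Fixpoint solution (t : nat) (i : 'I_(num_runs delta)) (w : T) : {set U} :=
  if t is t'.+1 then
    let S := solution t' i w in
    if sel S (draw t' i w) is Some u then u |: S else S
  else finset.set0.

Definition feasible (S : {set U}) := (1 - eps) * tau <= f S.

Definition loop_test (t : nat) (w : T) := forall i, ~ feasible (solution t i w).

Definition halts_at (t : nat) (w : T) :=
  (forall t', (t' < t)%N -> loop_test t' w) /\ ~ loop_test t w.

(* [stoch_greedy_c w S q]: on the outcome [w] of the samples, the algorithm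
   terminates and may return [S], having evaluated f [q] times.  Ties in the
   final argmin are broken arbitrarily. *)
Definition stoch_greedy_c (w : T) (S : {set U}) (q : nat) :=
  exists t i, [/\ halts_at t w,
    S = solution t i w, feasible S,
    forall j, feasible (solution t j w) -> (#|S| <= #|solution t j w|)%N &
    q = num_queries #|U| eps alpha delta t].

End Algorithm.

(* Main.v *)
(** Let [y = 1 + alpha], [L = ln (3 / eps)], [k = #|OPT|], and let [G] be the
    least guess that is at least [ceil L * k / L]; then [L * G <= y * ceil L * k].
    The guess is at most [G] in the first [j = floor (L * G) >= ceil L * k]
    iterations.  A sample of at least [n L / G] elements meets [OPT \ S] with
    probability at least [1 - exp (- L |OPT \ S| / G)], and by symmetry an element
    met is uniform in [OPT \ S], so one iteration multiplies the expected
    residual [tau - f_tau S] by at most [1 - (1 - exp (- L k / G)) / k].  After [j]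
    iterations the expected residual is at most [(3/2) exp (- L) tau = eps tau / 2],
    and Markov's inequality bounds by 1/2 the probability that a given run has
    failed.  The [m] runs are independent, hence all of them fail with
    probability at most [2 ^ - m <= delta].  Each guess [g] is used for about
    [L g alpha / y] iterations with samples of [n L / g] elements, and about
    [log_y k] guesses are used, which gives the bound on the queries. *)
Require Import Defs.
From mathcomp Require Import all_boot all_order all_algebra.
From mathcomp Require Import all_classical all_reals all_analysis.
From mathcomp Require Import perm ring lra.
Import Order.TTheory GRing.Theory Num.Theory.
Local Open Scope classical_set_scope.
Local Open Scope ring_scope.

Set Implicit Arguments.
Unset Strict Implicit.

(** * Numerical bounds on the exponential *)
Lemma expR_chord {R : realType} (a b w : R) : a < b -> a <= w <= b ->
  (b - a) * expR (- w) <= (b - w) * expR (- a) + (w - a) * expR (- b).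
Proof.
move=> ab /andP[aw wb].
have ba : 0 < b - a by rewrite subr_gt0.
have t0 : 0 <= (b - w) / (b - a) by rewrite divr_ge0 ?subr_ge0// ltW.
have t1 : (b - w) / (b - a) <= 1.
  by rewrite ler_pdivrMr // mul1r lerD2l lerN2.
have := convex_expR (Itv01 t0 t1) (- a) (- b).
rewrite !convRE /= /unstable.onem => H.
have E (u v : R) : (b - w) / (b - a) * u + (1 - (b - w) / (b - a)) * v =
    u + (w - a) / (b - a) * (v - u) by field; rewrite gt_eqF.
rewrite /= !E in H.
have -> : - w = - a + (w - a) / (b - a) * (- b - - a).
  by field; rewrite gt_eqF.
rewrite -(@ler_pM2l _ (b - a)) // in H; apply: le_trans H _.
rewrite le_eqVlt; apply/orP; left; apply/eqP.
by field; rewrite gt_eqF.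
Qed.

Lemma expR_ge_series {R : realType} (x : R) n : 0 <= x ->
  \sum_(0 <= i < n) x ^+ i / i`!%:R <= expR x.
Proof.
move=> x0; rewrite /expR.
apply: (nondecreasing_cvgn_le _ (@is_cvg_series_exp_coeff R x) n).
apply/nondecreasing_seqP => k; rewrite /series /= big_nat_recr //= lerDl.
by rewrite divr_ge0 // exprn_ge0.
Qed.

Lemma expR_ge_Xn {R : realType} (x : R) n : - n.+1%:R <= x ->
  (1 + x / n.+1%:R) ^+ n.+1 <= expR x.
Proof.
move=> xn; have n0 : (0 : R) < n.+1%:R by [].
have -> : expR x = expR (x / n.+1%:R) ^+ n.+1.
  by rewrite -expRM_natl mulrC divfK // gt_eqF.
rewrite lerXn2r ?nnegrE ?expR_ge0 ?expR_ge1Dx //.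
by rewrite -lerBlDl sub0r ler_pdivlMr // mulN1r.
Qed.

(** The function [x |-> 1 - exp(-x)] is concave and vanishes at 0, so it lies above its chords from
    the origin. *)
Lemma expR_scale {R : realType} (t x : R) : 0 <= t <= 1 -> 0 <= x ->
  t * (1 - expR (- x)) <= 1 - expR (- (t * x)).
Proof.
move=> /andP[t0 t1] x0; have [<-|x_neq0] := eqVneq 0 x.
  by rewrite mulr0 oppr0 expR0 subrr mulr0.
have xp : 0 < x by rewrite lt_neqAle x_neq0.
have h : 0 <= t * x <= x.
  by rewrite mulr_ge0 ?ler_piMl.
have := expR_chord xp h; rewrite oppr0 expR0 !addr0 mulr1 => H.
by rewrite -(@ler_pM2l _ x) //; lra.
Qed.

(** This is [expR_scale] at [A / x] with ratio [t = x / y], because [t * (A / x) = A / y]. *)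
Lemma expR_slope {R : realType} (A x y : R) : 0 <= A -> 0 < x <= y ->
  x * (1 - expR (- (A / x))) <= y * (1 - expR (- (A / y))).
Proof.
move=> A0 /andP[x0 xy]; have y0 := lt_le_trans x0 xy.
have t01 : 0 <= x / y <= 1 by rewrite ler_pdivrMr // mul1r xy andbT divr_ge0 // ltW.
have Ax : 0 <= A / x by rewrite divr_ge0 // ltW.
have := expR_scale t01 Ax.
have -> : x / y * (A / x) = A / y by field; rewrite !gt_eqF.
move=> H; have -> : x * (1 - expR (- (A / x))) =
    y * (x / y * (1 - expR (- (A / x)))) by field; rewrite gt_eqF.
by rewrite ler_pM2l.
Qed.

(** 81/200 is a rational just below ln(3/2): it is the slack that a factor 3/2 gives to the
    exponents below. *)
Lemma expR_0405 {R : realType} : expR (81 / 200) <= 3 / 2 :> R.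
Proof.
have sq (a c e : R) : 0 <= a <= e -> c <= a ^+ 2 -> c <= e ^+ 2.
  by move=> /andP[a0 ae] ca; apply: le_trans ca _; rewrite lerXn2r ?nnegrE //; lra.
(* The power 256 is reached by eight squarings, with short rational lower bounds in between. *)
have h0 : 2 / 3 <= (1 - 81 / 200 / 256) ^+ 256 :> R.
  rewrite (_ : forall x : R, x ^+ 256 =
    (((((((x ^+ 2) ^+ 2) ^+ 2) ^+ 2) ^+ 2) ^+ 2) ^+ 2) ^+ 2);
    last by move=> x; rewrite -!exprM.
  apply: (@sq ((8165 + 497 / 1000) / 10000)); last lra.
  apply/andP; split; first lra.
  apply: (@sq ((9036 + 314 / 1000) / 10000)); last lra.
  apply/andP; split; first lra.
  apply: (@sq ((9505 + 953 / 1000) / 10000)); last lra.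
  apply/andP; split; first lra.
  apply: (@sq ((9749 + 848 / 1000) / 10000)); last lra.
  apply/andP; split; first lra.
  apply: (@sq ((9874 + 132 / 1000) / 10000)); last lra.
  apply/andP; split; first lra.
  apply: (@sq ((9936 + 867 / 1000) / 10000)); last lra.
  apply/andP; split; first lra.
  apply: (@sq ((9968 + 384 / 1000) / 10000)); last lra.
  apply/andP; split; first lra.
  lra.
have h : (2 : R) / 3 <= expR (- (81 / 200)).
  apply: le_trans h0 _.
  have -> : 1 - 81 / 200 / 256 = 1 + - (81 / 200) / 256 :> R by field.
  by apply: expR_ge_Xn; rewrite lerN2; lra.
clear h0.
rewrite -[81 / 200]opprK expRN -[3 / 2]invf_div lef_pV2 ?posrE ?expR_gt0 //; lra.
Qed.

(** The factor [1 - exp(-A/x)] decreases in [x], so subtracting [c] times it keeps the monotonicity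
    of [expR_slope]. *)
Lemma expR_slope_shift {R : realType} (A x y c : R) : 0 <= A -> 0 < x <= y -> 0 <= c ->
  (x - c) * (1 - expR (- (A / x))) <= (y - c) * (1 - expR (- (A / y))).
Proof.
move=> A0 /andP[x0 xy] c0; have y0 := lt_le_trans x0 xy.
have := @expR_slope _ A x y A0; rewrite x0 xy => /(_ isT).
have : expR (- (A / x)) <= expR (- (A / y)).
  by rewrite ler_expR lerN2 ler_wpM2l // lef_pV2 ?posrE.
nra.
Qed.

(** The arguments are 2/5 of the nodes 23/20, 12/5 and 4 of the chords below. *)
Lemma expR_le_numerals {R : realType} :
  [/\ expR (- (23 / 50)) <= 79 / 125 :> R,
      expR (- (24 / 25)) <= 383 / 1000 :> R &
      expR (- (8 / 5)) <= 101 / 500 :> R].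
Proof.
have inv (x c : R) : 0 < c -> c^-1 <= expR x -> expR (- x) <= c.
  by move=> c0 H; rewrite expRN -[leRHS]invrK lef_pV2 ?posrE ?invr_gt0 ?expR_gt0.
split; (apply: inv; first lra).
- apply: le_trans (expR_ge_series 5 _); last lra.
  by rewrite unlock /= !factS fact0 !muln1 ?natrM; lra.
- apply: le_trans (expR_ge_series 8 _); last lra.
  by rewrite unlock /= !factS fact0 !muln1 ?natrM; lra.
- apply: le_trans (expR_ge_series 9 _); last lra.
  by rewrite unlock /= !factS fact0 !muln1 ?natrM; lra.
Qed.

(* Chords of the concave function [x |-> 1 - exp(-(2/5) x)], at [x = L ^ 2],
   with nodes [23/20], [12/5] and [4]. *)
Lemma exponent_lt2 {R : realType} (L : R) : 27 / 25 <= L <= 2 ->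
  L - 81 / 200 <= 2 * (1 - expR (- (L ^+ 2 / (2 + 1 / 2)))).
Proof.
move=> /andP[L1 L2]; have [e1 e2 e3] := @expR_le_numerals R.
have -> : L ^+ 2 / (2 + 1 / 2) = 2 / 5 * L ^+ 2 by field.
have w1 : 23 / 50 <= 2 / 5 * L ^+ 2 by nra.
have w2 : 2 / 5 * L ^+ 2 <= 8 / 5 by nra.
have [w wE] : exists w, w = 2 / 5 * L ^+ 2 by eexists.
rewrite -wE in w1 w2 *.
have [w3|/ltW w3] := leP w (24 / 25).
- have H : (24 / 25 - 23 / 50) * expR (- w) <=
      (24 / 25 - w) * (79 / 125) + (w - 23 / 50) * (383 / 1000).
    apply: le_trans (expR_chord _ _) _; [lra | lra |].
    by apply: lerD; rewrite ler_wpM2l //; lra.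
  (* The chord leaves a quadratic inequality in [L] with positive leading coefficient and vertex
     close to 126/100. *)
  by have := sqr_ge0 (L - 126 / 100); lra.
- have H : (8 / 5 - 24 / 25) * expR (- w) <=
      (8 / 5 - w) * (383 / 1000) + (w - 24 / 25) * (101 / 500).
    apply: le_trans (expR_chord _ _) _; [lra | lra |].
    by apply: lerD; rewrite ler_wpM2l //; lra.
  by have := sqr_ge0 (2 - L); lra.
Qed.

(** At [L = 2] one has [z = 8/5]; beyond it [L / 2 <= 1 + (z - 8/5) <= exp(z - 8/5)], so
    [L exp(-z) <= 2 exp(-8/5) < 81/200]. *)
Lemma exponent_ge2 {R : realType} (L : R) : 2 <= L ->
  L - 81 / 200 <= L * (1 - expR (- (L ^+ 2 / (L + 1 / 2)))).
Proof.
move=> L2; have [_ _ e3] := @expR_le_numerals R.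
set z := L ^+ 2 / _.
have L12 : 0 < L + 1 / 2 by lra.
have zL : L / 2 <= 1 + (z - 8 / 5).
  suff : L / 2 + 3 / 5 <= z by lra.
  by rewrite /z ler_pdivlMr //; nra.
have h : L / 2 * expR (- z) <= expR (- (8 / 5)).
  have -> : expR (- (8 / 5)) = expR (z - 8 / 5) * expR (- z) :> R.
    by rewrite -expRD; congr expR; lra.
  rewrite ler_wpM2r ?expR_ge0 //; apply: le_trans zL _; exact: expR_ge1Dx.
lra.
Qed.

(** Here [m] stands for ceil L, and 1/2 dominates 1/k for [k >= 2]. The right side increases with
    [m], which leaves [m = 2] if [L <= 2] and [m = L] otherwise. *)
Lemma exponent_bound {R : realType} (L m : R) : 27 / 25 <= L <= m -> 2 <= m ->
  L - 81 / 200 <= m * (1 - expR (- (L ^+ 2 / (m + 1 / 2)))).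
Proof.
move=> /andP[L1 Lm] m2.
have shift (x : R) : 0 <= x <= m -> x * (1 - expR (- (L ^+ 2 / (x + 1 / 2)))) <=
    m * (1 - expR (- (L ^+ 2 / (m + 1 / 2)))).
  move=> /andP[x0 xm].
  have := @expR_slope_shift R (L ^+ 2) (x + 1 / 2) (m + 1 / 2) (1 / 2).
  rewrite !addrK; apply; [exact: sqr_ge0| | lra].
  by apply/andP; split; lra.
have [L2|/ltW L2] := leP L 2.
- by apply: le_trans (shift 2 _); [apply: exponent_lt2; lra | lra].
- by apply: le_trans (shift L _); [apply: exponent_ge2 | lra].
Qed.

(* [j] is the integer part of [L * G].  The estimate [1 - x <= exp(- x)] suffices
   for [2 <= k], but with [k = 1] it would be too weak. *)
Lemma residual_decay {R : realType} (L G : R) (k j c : nat) :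
  (0 < k)%N -> (2 <= c)%N -> (c * k <= j)%N -> 27 / 25 <= L <= c%:R ->
  0 < G -> L * G <= j.+1%:R ->
  (1 - (1 - expR (- (L * k%:R / G))) / k%:R) ^+ j <= 3 / 2 * expR (- L).
Proof.
move=> k0 c2 ckj /andP[L1 Lc] G0 LGj.
have fin (X : R) : L - 81 / 200 <= X -> expR (- X) <= 3 / 2 * expR (- L).
  move=> LX; have := @expR_0405 R => h.
  apply: le_trans (_ : expR (81 / 200 - L) <= _); first by rewrite ler_expR; lra.
  by rewrite expRD ler_wpM2r // expR_ge0.
have L0 : 0 < L by lra.
have j0 : 0 < j.+1%:R :> R by rewrite ltr0n.
have kR : 1 <= k%:R :> R by rewrite ler1n.
have rate : L ^+ 2 * k%:R / j.+1%:R <= L * k%:R / G.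
  rewrite ler_pdivrMr // [leRHS]mulrAC ler_pdivlMr //.
  have -> : L ^+ 2 * k%:R * G = L * k%:R * (L * G) by ring.
  by rewrite ler_wpM2l // mulr_ge0 //; lra.
have [k1|k1] := leqP k 1.
- have {k1}kE : k = 1%N by apply/eqP; rewrite eqn_leq k1.
  subst k; rewrite muln1 !mulr1 in ckj rate *.
  (* For [k = 1] the base is exactly exp(-L/G), and [j >= 2] gives [j / (j + 1) >= 2/3]. *)
  rewrite divr1 opprB addrC subrK -expRM_natl mulrN; apply: fin.
  have j2 : 2 <= j%:R :> R by rewrite (ler_nat R 2); apply: leq_trans ckj.
  apply: le_trans (_ : j%:R * (L ^+ 2 / j.+1%:R) <= _); last first.
    by rewrite ler_wpM2l // ler0n.
  apply: le_trans (_ : 2 / 3 * L ^+ 2 <= _).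
    by have := sqr_ge0 (L - 3 / 4); nra.
  rewrite [leRHS]mulrCA [leRHS]mulrC ler_wpM2r ?sqr_ge0 // ler_pdivlMr // -natr1; lra.
- have kR2 : 2 <= k%:R :> R by rewrite (ler_nat R 2).
  have cR2 : 2 <= c%:R :> R by rewrite (ler_nat R 2).
  set p := 1 - expR _.
  have p01 : 0 <= p <= 1.
    rewrite /p subr_ge0 -expR0 ler_expR oppr_le0 divr_ge0 ?mulr_ge0 //; try lra.
    by rewrite expR0 gerBl expR_ge0.
  have pk : p / k%:R <= 1 by rewrite ler_pdivrMr; lra.
  apply: le_trans (_ : expR (- (p / k%:R)) ^+ j <= _).
    by rewrite lerXn2r ?nnegrE ?expR_ge0 ?subr_ge0 // expR_ge1Dx.
  rewrite -expRM_natl mulrN; apply: fin.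
  apply: le_trans (exponent_bound _ cR2) _; first by rewrite L1.
  rewrite mulrA ler_pdivlMr; last lra.
  have A0 : 0 <= L ^+ 2 * k%:R by rewrite mulr_ge0 ?sqr_ge0 //; lra.
  have ckj1 : 0 < ((c * k).+1%:R : R) <= j.+1%:R by rewrite ltr0n ler_nat ltnS.
  (* Monotonicity with shift 1 lowers [j.+1] to [(c * k).+1], where [c * k + 1 <= (c + 1/2) * k]
     brings in [exponent_bound]. *)
  have := @expR_slope_shift R _ _ _ 1 A0 ckj1 ler01.
  rewrite -[(c * k).+1%:R]natr1 -[X in _ <= (X - 1) * _ -> _]natr1 !addrK => H.
  apply: le_trans (_ : j%:R * (1 - expR (- (L ^+ 2 * k%:R / j.+1%:R))) <= _).
    apply: le_trans H; rewrite natrM mulrAC ler_wpM2l ?mulr_ge0 //; try lra.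
    rewrite lerD2l lerN2 ler_expR lerN2 ler_pdivrMr; last lra.
    rewrite mulrAC ler_pdivlMr; last by nra.
    have := sqr_ge0 L; nra.
  by rewrite ler_wpM2l // lerD2l lerN2 ler_expR lerN2.
Qed.

Lemma ln3_ge {R : realType} : 27 / 25 <= ln 3 :> R.
Proof.
suff h : 1 / 3 <= expR (- (27 / 25)) :> R.
  rewrite -ler_expR lnK ?posrE // -[27 / 25]opprK expRN -[3]invrK.
  by rewrite lef_pV2 ?posrE ?expR_gt0 ?invr_gt0 // -div1r.
apply: le_trans (_ : (1 - 27 / 25 / 64) ^+ 64 <= _); last first.
  have -> : 1 - 27 / 25 / 64 = 1 + - (27 / 25) / 64 :> R by field.
  by apply: expR_ge_Xn; rewrite lerN2; lra.
rewrite (_ : forall x : R, x ^+ 64 =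
  (((((x ^+ 2) ^+ 2) ^+ 2) ^+ 2) ^+ 2) ^+ 2);
  last by move=> x; rewrite -!exprM.
have sq (a c e : R) : 0 <= a <= e -> c <= a ^+ 2 -> c <= e ^+ 2.
  by move=> /andP[a0 ae] ca; apply: le_trans ca _; rewrite lerXn2r ?nnegrE //; lra.
apply: (@sq (5792 / 10000)); last lra.
apply/andP; split; first lra.
apply: (@sq (7611 / 10000)); last lra.
apply/andP; split; first lra.
apply: (@sq (8725 / 10000)); last lra.
apply/andP; split; first lra.
apply: (@sq (9341 / 10000)); last lra.
apply/andP; split; first lra.
apply: (@sq (9665 / 10000)); last lra.
apply/andP; split; first lra.
lra.
Qed.

(** * One greedy step on a uniform sample *)
(** A sample without replacement misses [o] given elements at most as often as one with replacement:
    each further draw contributes [(a - s) / (n - s) <= a / n], with [a = n - o]. *)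
Lemma bin_sub_le (n o s : nat) :
  ('C(n - o, s) * n ^ s <= 'C(n, s) * (n - o) ^ s)%N.
Proof.
move: (n - o)%N (leq_subr o n) => a an; elim: s => [|s IH]; first by rewrite !bin0.
have key : ((a - s) * n <= (n - s) * a)%N.
  have [sa|/ltnW sa] := leqP s a; last by rewrite (eqP sa).
  have : (s * a <= s * n)%N by rewrite leq_mul2l an orbT.
  by rewrite !mulnBl (mulnC n a); apply: leq_sub2l.
rewrite -(leq_pmul2l (ltn0Sn s)) !mulnA !mul_bin_left !expnS.
have := leq_mul key IH; congr (_ <= _)%N; ring.
Qed.

Section UniformSample.
Context {R : realType} {U : finType}.
Implicit Types (A O S : {set U}) (h : U -> R) (s : nat).

Definition uniform_mass s A : R := if #|A| == s then 'C(#|U|, s)%:R^-1 else 0.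

Lemma uniform_mass_ge0 s A : 0 <= uniform_mass s A.
Proof. by rewrite /uniform_mass; case: ifP => // _; rewrite invr_ge0. Qed.

Lemma sum_uniform_mass s : (s <= #|U|)%N -> \sum_A uniform_mass s A = 1.
Proof.
move=> sU; rewrite /uniform_mass -big_mkcond /=.
rewrite (eq_bigl (mem [set A : {set U} | #|A| == s]%SET)) => [|A]; last by rewrite /= inE.
by rewrite sumr_const card_draws -[_ *+ _]mulr_natr mulVf // pnatr_eq0 -lt0n bin_gt0.
Qed.

Definition hits s O : nat := #|[set A : {set U} | (#|A| == s) && (A :&: O != finset.set0)]%SET|.

Lemma hitsE s O : ('C(#|U|, s) = hits s O + 'C(#|U| - #|O|, s))%N.
Proof.
rewrite -card_draws -(finset.cardsID [set A : {set U} | A :&: O != finset.set0]%SET).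
congr (_ + _)%N.
  by apply: eq_card => A; rewrite !inE.
have -> : (#|U| - #|O| = #|~: O|)%N by rewrite -(finset.cardsC O) addKn.
rewrite -cards_draws; apply: eq_card => A; rewrite !inE negbK.
by rewrite finset.setI_eq0 finset.disjoints_subset.
Qed.

(* The weight of [x] does not depend on [x], as transpositions of elements of
   [O] preserve the uniform distribution on the samples. *)
Lemma sum_average s O h : (0 < #|O|)%N ->
  \sum_(A : {set U} | #|A| == s) (\sum_(x in A :&: O) h x) / #|A :&: O|%:R =
  (hits s O)%:R / #|O|%:R * \sum_(x in O) h x.
Proof.
move=> O0.
pose w x : R := \sum_(A : {set U} | (#|A| == s) && (x \in A)) #|A :&: O|%:R^-1.
have -> : \sum_(A : {set U} | #|A| == s) (\sum_(x in A :&: O) h x) / #|A :&: O|%:R =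
    \sum_(x in O) h x * w x.
  under eq_bigr do rewrite mulr_suml.
  rewrite (exchange_big_dep (mem O)) /=; last by move=> A x _; rewrite inE => /andP[].
  apply: eq_bigr => x xO; rewrite /w mulr_sumr.
  by apply: eq_bigl => A; rewrite inE xO andbT.
have wE x y : x \in O -> y \in O -> w x = w y.
  move=> xO yO; have f_inj := @perm_inj _ (tperm x y).
  rewrite /w (reindex_inj (imset_inj f_inj)) /=.
  apply: eq_big => A.
    rewrite card_imset //; congr (_ && _).
    by rewrite -{1}(tpermR x y) finset.mem_imset.
  move=> _; congr (_%:R^-1).
  have {1}<- : tperm x y @: O = O.
    apply: im_perm_on; apply: fintype.subset_trans (tperm_on x y) _.
    by apply/fintype.subsetP => z; rewrite !inE => /orP[] /eqP ->.
  by rewrite -imsetI ?card_imset // => z t _ _; apply: f_inj.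
(* Each sample meeting [O] spreads a total weight 1 over its elements in [O]; the other samples
   contribute 0. *)
have ws : \sum_(x in O) w x = (hits s O)%:R.
  rewrite /w (exchange_big_dep (fun A : {set U} => #|A| == s)) /=; last by move=> x A _ /andP[].
  rewrite /hits -sum1_card natr_sum big_mkcond [RHS]big_mkcond /=.
  apply: eq_bigr => A _; rewrite inE; case: (#|A| == s) => //=.
  rewrite (eq_bigl (mem (A :&: O))) => [|x]; last by rewrite /= inE andbC.
  rewrite sumr_const -finset.card_gt0 -[_ *+ _]mulr_natr.
  case: posnP => [->|AO]; first by rewrite mulr0.
  by rewrite mulVf // pnatr_eq0 -lt0n.
have /card_gt0P[x0 x0O] := O0.
have w0 : w x0 = (hits s O)%:R / #|O|%:R.
  rewrite -ws (eq_bigr (fun=> w x0)) => [|x xO]; last exact: wE.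
  by rewrite sumr_const -[w x0 *+ _]mulr_natr mulfK ?pnatr_eq0 -?lt0n.
rewrite -w0 mulr_sumr.
by apply: eq_bigr => x xO; rewrite mulrC (wE x x0).
Qed.

End UniformSample.

(** * Expected residual after one greedy step *)

Section GreedyStep.
Context {R : realType} {U : finType}.
Context (f : {set U} -> R) (tau : R) (OPT : {set U}).
Context (sel : {set U} -> {set U} -> option U).
Context (f_mono : set_monotone f) (f_sub : submodular f).
Context (OPT_tau : tau <= f OPT) (OPT_gt0 : (0 < #|OPT|)%N).
Context (sel_argmax : argmax_rule f tau sel).

Definition greedy_step (S A : {set U}) := if sel S A is Some u then u |: S else S.

Definition residual (S : {set U}) := tau - truncated f tau S.

Lemma residual_ge0 S : 0 <= residual S.
Proof. by rewrite subr_ge0 ge_min lexx orbT. Qed.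

Lemma gain_ge0 S u : 0 <= gain f tau S u.
Proof.
rewrite /gain subr_ge0 /truncated le_min !ge_min lexx orbT andbT.
by rewrite f_mono ?finset.subsetUr.
Qed.

(** The elements of [O] are added one at a time; by submodularity the marginal of [x] over
    [S :|: (O :\ x)] is at most the one over [S]. *)
Lemma sum_marginals S (O : {set U}) : f (S :|: O) - f S <= \sum_(x in O) (f (x |: S) - f S).
Proof.
move: {2}#|O| (leqnn #|O|) => n; elim: n O => [|n IH] O.
  rewrite leqn0 cards_eq0 => /eqP ->.
  by rewrite big_set0 finset.setU0 subrr.
have [->|[x xO]] := finset.set_0Vmem O.
  by rewrite big_set0 finset.setU0 subrr.
rewrite (cardsD1 x) xO ltnS => /IH {}IH.
rewrite (big_setD1 x) //= -{1}(finset.setD1K xO) finset.setUCA.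
set B := S :|: _ in IH *; apply: le_trans (lerD (lexx _) IH).
rewrite addrA lerD2r.
have [xB|xB] := boolP (x \in B).
  rewrite (finset.setUidPr _) ?finset.sub1set //.
  by rewrite lerDr subr_ge0 f_mono // finset.subsetUr.
have := f_sub (finset.subsetUl S (O :\ x)) xB; rewrite -/B; lra.
Qed.

(** Submodularity is applied to [f] itself: either [S] reaches [tau], or a single element closes the
    whole residual, or the truncation is inactive at every [x |: S] and [sum_marginals] applies. *)
Lemma residual_le_gains S :
  residual S <= \sum_(x in OPT :\: S) gain f tau S x.
Proof.
have [fS|fS] := leP tau (f S).
  rewrite /residual /truncated min_r // subrr; apply: sumr_ge0 => x _; exact: gain_ge0.
have tS : truncated f tau S = f S by rewrite /truncated min_l // ltW.
have [/existsP[x /andP[xO fx]]|/existsPn no_x] :=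
  boolP [exists x, (x \in OPT :\: S) && (tau <= f (x |: S))].
  have gE : gain f tau S x = residual S.
    by rewrite /gain /residual [truncated f tau (x |: S)]min_r.
  rewrite (bigD1 x) //= gE lerDl.
  by apply: sumr_ge0 => y _; apply: gain_ge0.
have gE x : x \in OPT :\: S -> gain f tau S x = f (x |: S) - f S.
  move=> xO; have := no_x x; rewrite xO /= -ltNge => fx.
  by rewrite /gain tS /truncated min_l // ltW.
rewrite (eq_bigr _ gE) /residual tS.
apply: le_trans (sum_marginals S (OPT :\: S)); rewrite lerD2r.
apply: le_trans OPT_tau _; apply: f_mono.
by apply/fintype.subsetP => x xO; rewrite !inE xO andbT orbN.
Qed.

(** The maximal gain over the sample is at least the average over [A :&: O]; if this set is empty,
    division by 0 makes the average 0. *)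
Lemma residual_step_le_average S A (O : {set U}) :
  residual (greedy_step S A) <=
  residual S - (\sum_(x in A :&: O) gain f tau S x) / #|A :&: O|%:R.
Proof.
rewrite /greedy_step; have := sel_argmax S A.
case: (sel S A) => [u [uA u_max]|->]; last first.
  by rewrite finset.set0I big_set0 mul0r subr0.
have -> : residual (u |: S) = residual S - gain f tau S u.
  by rewrite /residual /gain; ring.
rewrite lerD2l lerN2.
case: (posnP #|A :&: O|) => [->|AO]; first by rewrite invr0 mulr0 gain_ge0.
rewrite ler_pdivrMr ?ltr0n // mulr_natr -sumr_const.
by apply: ler_sum => x; rewrite inE => /andP[xA _]; apply: u_max.
Qed.

(** [lam] stands for [L / G], and the disjunction reflects the minimum in [sample_size]. The mean
    gain is at least the probability of meeting [O = OPT :\: S], divided by [#|O|], times the sum of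
    the gains over [O]. *)
Lemma expected_residual_step S (s : nat) (lam : R) : (s <= #|U|)%N -> 0 <= lam ->
  s = #|U| \/ #|U|%:R * lam <= s%:R ->
  \sum_A uniform_mass s A * residual (greedy_step S A) <=
  (1 - (1 - expR (- (lam * #|OPT|%:R))) / #|OPT|%:R) * residual S.
Proof.
move=> sU lam0 s_large; have k_gt0 := OPT_gt0; set k := #|OPT| in k_gt0 *; set p := 1 - expR _.
have n0 : (0 < #|U|)%N := leq_trans OPT_gt0 (max_card _).
set O := OPT :\: S; have Ok : (#|O| <= k)%N by rewrite subset_leq_card // finset.subsetDl.
have step : \sum_A uniform_mass s A * residual (greedy_step S A) <=
    residual S - \sum_A uniform_mass s A *
      ((\sum_(x in A :&: O) gain f tau S x) / #|A :&: O|%:R).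
  have -> : residual S = \sum_(A : {set U}) uniform_mass s A * residual S.
    by rewrite -mulr_suml sum_uniform_mass // mul1r.
  rewrite -sumrB.
  apply: ler_sum => A _; rewrite -mulrBr ler_wpM2l ?uniform_mass_ge0 //.
  exact: residual_step_le_average.
case: (posnP #|O|) => O0.
  have S0 : residual S = 0.
    apply/eqP; rewrite eq_le residual_ge0 andbT.
    apply: le_trans (residual_le_gains S) _; rewrite -/O.
    by move/cards0_eq: O0 => ->; rewrite big_set0.
  rewrite S0 mulr0; apply: le_trans step _; rewrite S0 sub0r oppr_le0.
  apply: sumr_ge0 => A _; rewrite mulr_ge0 ?uniform_mass_ge0 // divr_ge0 //.
  by apply: sumr_ge0 => x _; apply: gain_ge0.
apply: le_trans step _; rewrite mulrBl mul1r lerD2l lerN2.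
have -> : \sum_A uniform_mass s A *
      ((\sum_(x in A :&: O) gain f tau S x) / #|A :&: O|%:R) =
    (hits s O)%:R / 'C(#|U|, s)%:R / #|O|%:R * \sum_(x in O) gain f tau S x.
  rewrite [_ / _ / _]mulrAC [RHS]mulrAC -sum_average // mulrC mulr_sumr [RHS]big_mkcond /=.
  apply: eq_bigr => A _; rewrite /uniform_mass.
  by case: ifP => _; rewrite ?mul0r.
have C0 : 0 < 'C(#|U|, s)%:R :> R by rewrite ltr0n bin_gt0.
have O0' : 0 < #|O|%:R :> R by rewrite ltr0n.
have k0 : 0 < k%:R :> R by rewrite ltr0n.
have nR : 0 < #|U|%:R :> R by rewrite ltr0n.
have OU : (#|O| <= #|U|)%N := max_card _.
apply: ler_pM; rewrite ?residual_ge0 ?residual_le_gains //.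
  rewrite divr_ge0 // subr_ge0 -expR0 ler_expR oppr_le0 mulr_ge0 //.
(* Concavity replaces [#|O|] by the larger [k]. *)
apply: le_trans (_ : (1 - expR (- (lam * #|O|%:R))) / #|O|%:R <= _).
  have t01 : 0 <= (#|O|%:R / k%:R : R) <= 1.
    by rewrite divr_ge0 // ler_pdivrMr // mul1r ler_nat.
  have x0 : 0 <= lam * k%:R by rewrite mulr_ge0.
  have := expR_scale t01 x0; rewrite -/p.
  have -> : #|O|%:R / k%:R * (lam * k%:R) = lam * #|O|%:R by field; rewrite gt_eqF.
  rewrite ler_pdivlMr // => H; apply: le_trans H.
  by rewrite le_eqVlt; apply/orP; left; apply/eqP; ring.
rewrite ler_wpM2r ?invr_ge0 //.
have -> : (hits s O)%:R / 'C(#|U|, s)%:R = 1 - 'C(#|U| - #|O|, s)%:R / 'C(#|U|, s)%:R :> R.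
  have := congr1 (fun i => i%:R : R) (hitsE s O); rewrite natrD => hE.
  by rewrite hE; field; rewrite -hE gt_eqF.
rewrite lerD2l lerN2.
(* A full sample cannot miss the nonempty [O]; otherwise [bin_sub_le] applies. *)
case: s_large => [sE|s_large].
  by rewrite bin_small ?mul0r ?expR_ge0 // sE ltn_subrL n0 O0.
have h : 'C(#|U| - #|O|, s)%:R / 'C(#|U|, s)%:R <= ((#|U| - #|O|)%N%:R / #|U|%:R) ^+ s :> R.
  rewrite expr_div_n ler_pdivrMr // mulrAC ler_pdivlMr ?exprn_gt0 //.
  by rewrite -!natrX -!natrM ler_nat [leqRHS]mulnC bin_sub_le.
apply: le_trans h _.
apply: le_trans (_ : expR (- (#|O|%:R / #|U|%:R)) ^+ s <= _).
  rewrite lerXn2r ?nnegrE ?expR_ge0 ?divr_ge0 //.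
  apply: le_trans (expR_ge1Dx _); rewrite natrB // mulrBl mulfV ?gt_eqF //.
rewrite -expRM_natl ler_expR mulrN lerN2.
rewrite mulrCA mulrC ler_wpM2l // ler_pdivlMr // mulrC; exact: s_large.
Qed.

End GreedyStep.

(** * The schedule of the guesses *)
(** Bernoulli's inequality gives a power above [x], and the least one with positive exponent is at
    most [y * x], as otherwise its predecessor would do. Exponents start at 1 because the first
    guess is [y]. *)
Lemma power_between {R : realType} (y x : R) : 1 < y -> 1 <= x ->
  exists i, x <= y ^+ i.+1 <= y * x.
Proof.
move=> y1 x1; have y0 : 0 < y by lra.
have bern n : 1 + n%:R * (y - 1) <= y ^+ n.
  elim: n => [|n IH]; first by rewrite mul0r addr0 expr0.
  rewrite exprS -natr1; move: IH; rewrite -(ler_pM2l y0).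
  have : 0 <= n%:R * (y - 1) ^+ 2 by rewrite mulr_ge0 ?sqr_ge0.
  lra.
have ex : exists n, x <= y ^+ n.+1.
  exists (Num.truncn (x / (y - 1))); apply: le_trans (bern _).
  have y10 : 0 < y - 1 by rewrite subr_gt0.
  have := truncnS_gt (x / (y - 1)); rewrite ltr_pdivrMr //.
  by move=> /ltW h; apply: le_trans h _; rewrite lerDr.
have [[|i] xi min_i] := ex_minnP ex.
  by exists 0%N; rewrite xi expr1 ler_peMr // ltW.
exists i.+1; rewrite xi exprS ler_pM2l //= leNgt; apply/negP => h.
by have := min_i _ (ltW h); rewrite ltnn.
Qed.

Section Schedule.
Context {R : realType} (eps alpha : R).
Context (eps01 : 0 < eps <= 1) (alpha_gt0 : 0 < alpha).

Local Notation L := (ln (3 / eps)).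
Local Notation y := (1 + alpha).
Local Notation g := (guess eps alpha).

Lemma base_gt1 : 1 < y. Proof. by have := alpha_gt0; lra. Qed.

Lemma log_ge : 27 / 25 <= L.
Proof.
case/andP: eps01 => e0 e1; apply: le_trans ln3_ge _.
by rewrite ler_ln ?posrE ?divr_gt0 // ler_pdivlMr //; lra.
Qed.

Lemma log_ceil : L <= `|Num.ceil L|%N%:R /\ (2 <= `|Num.ceil L|)%N.
Proof.
have L1 := log_ge.
have c0 : 0 <= Num.ceil L by rewrite ceil_ge0; lra.
have -> : `|Num.ceil L|%N%:R = (Num.ceil L)%:~R :> R.
  by rewrite -[in RHS](gez0_abs c0).
split; first exact: ceil_ge.
rewrite -ltz_nat gez0_abs // ceil_gt_int; lra.
Qed.

Lemma guess_pow t : exists i, g t = y ^+ i.+1.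
Proof.
elim: t => [|t [i IH]] /=; first by exists 0%N; rewrite expr1.
by case: ifP => _; [exists i.+1; rewrite IH -exprS | exists i].
Qed.

Lemma guess_ge t : y <= g t.
Proof.
have [i ->] := guess_pow t; have y1 := ltW base_gt1.
by rewrite exprS ler_peMr ?exprn_ege1 //; lra.
Qed.

Lemma guess_gt0 t : 0 < g t.
Proof. by have := guess_ge t; have := base_gt1; lra. Qed.

(** A change of guess before the counter passes [L * y ^ i.+1] starts from a strictly smaller power
    of [y], so it ends at [y ^ i.+1] at most. *)
Lemma guess_le_pow i t : t.+1%:R <= L * y ^+ i.+1 -> g t <= y ^+ i.+1.
Proof.
have L1 := log_ge; have y1 := base_gt1; elim: t => [|t IH] tL /=.
  by rewrite exprS ler_peMr ?exprn_ege1 ?ltW //; lra.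
case: ifP => [Lg|_]; last by apply: IH; apply: le_trans tL; rewrite ler_nat.
have : g t < y ^+ i.+1 by rewrite -(@ltr_pM2l _ L); lra.
have [i' ->] := guess_pow t.
rewrite ltr_eXn2l // => ii; rewrite -exprS ler_eXn2l //.
Qed.

(** At a change the counter exceeds [L] times the old guess, that is [L / y] times the new one;
    afterwards it only grows. *)
Lemma guess_le_iter t : g t <= y \/ L * g t <= y * t.+1%:R.
Proof.
have L1 := log_ge; have y1 := base_gt1; elim: t => [|t IH] /=; first by left.
case: ifP => [Lg|_]; first by right; rewrite mulrCA ler_pM2l ?ltW //; lra.
case: IH => [|IH]; [by left | right].
by apply: le_trans IH _; rewrite ler_pM2l ?ler_nat //; lra.
Qed.

Lemma horizon (k c : nat) : (0 < k)%N -> L <= c%:R ->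
  exists j G, [/\ (c * k <= j)%N, j%:R <= y * c%:R * k%:R, 0 < G,
    L * G <= j.+1%:R & forall t, (t < j)%N -> g t <= G].
Proof.
move=> k0 Lc; have L1 := log_ge; have y1 := base_gt1.
have x1 : 1 <= c%:R * k%:R / L.
  rewrite ler_pdivlMr; last lra.
  by have : 1 <= k%:R :> R; [rewrite ler1n | nra].
have [i /andP[xi iy]] := power_between y1 x1.
have LG0 : 0 <= L * y ^+ i.+1 by rewrite mulr_ge0 ?exprn_ge0 //; lra.
have /andP[j1 j2] := truncn_itv LG0.
exists (Num.truncn (L * y ^+ i.+1)), (y ^+ i.+1); split.
- rewrite truncn_ge_nat // natrM.
  by move: xi; rewrite ler_pdivrMr ?[_ * L]mulrC //; lra.
- apply: le_trans j1 _.
  have L0 : 0 < L by lra.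
  rewrite -(ler_pM2l L0) in iy.
  apply: le_trans iy _; rewrite le_eqVlt; apply/orP; left; apply/eqP.
  by field; lra.
- by rewrite exprn_gt0; lra.
- exact: ltW.
- by move=> t tj; apply: guess_le_pow; apply: le_trans j1; rewrite ler_nat.
Qed.

Lemma sample_size_large (n t : nat) (G : R) : g t <= G ->
  sample_size n eps alpha t = n \/ n%:R * (L / G) <= (sample_size n eps alpha t)%:R.
Proof.
move=> gG; have L1 := log_ge; have y1 := base_gt1; have g0 := guess_gt0 t.
rewrite /sample_size; set s := `|_|%N.
have hs : n%:R * (L / G) <= s%:R.
  apply: le_trans (_ : n%:R * L / g t <= _).
    rewrite mulrA ler_wpM2l ?mulr_ge0 ?lef_pV2 ?posrE //; lra.
  have x0 : 0 <= n%:R * L / g t by rewrite divr_ge0 ?mulr_ge0 //; lra.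
  have c0 : 0 <= Num.ceil (n%:R * L / g t) by rewrite ceil_ge0; lra.
  have -> : s%:R = (Num.ceil (n%:R * L / g t))%:~R :> R by rewrite -[in RHS](gez0_abs c0).
  exact: ceil_ge.
by case: leqP; [left | right].
Qed.

End Schedule.

(** * The joint law of the runs *)
Section RunLaw.
Context {R : realType} {U : finType}.
Context (f : {set U} -> R) (tau eps alpha : R) (OPT : {set U}).
Context (sel : {set U} -> {set U} -> option U).

Local Notation mass t := (@uniform_mass R U (sample_size #|U| eps alpha t)).

(** The law of one run as a finite Markov chain driven by independent uniform samples, without
    reference to the probability space; [joint_law] makes the connection. *)
Fixpoint run_law (t : nat) (S : {set U}) : R :=
  if t is t'.+1 then
    \sum_(p : {set U} * {set U})
      if greedy_step sel p.1 p.2 == S then run_law t' p.1 * mass t' p.2 else 0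
  else (S == finset.set0)%:R.

Lemma run_law_ge0 t S : 0 <= run_law t S.
Proof.
elim: t S => [|t IH] S //=; apply: sumr_ge0 => p _.
by case: ifP => // _; rewrite mulr_ge0 ?uniform_mass_ge0.
Qed.

Lemma sum_run_lawS t (h : {set U} -> R) :
  \sum_S run_law t.+1 S * h S =
  \sum_S run_law t S * \sum_A mass t A * h (greedy_step sel S A).
Proof.
under eq_bigr do rewrite /= mulr_suml.
rewrite exchange_big /=.
under [RHS]eq_bigr do rewrite mulr_sumr.
rewrite [RHS]pair_big /=; apply: eq_bigr => p _.
rewrite (bigD1 (greedy_step sel p.1 p.2)) //= eqxx big1 ?addr0 => [|S].
  by rewrite mulrA.
by rewrite eq_sym => /negPf ->; rewrite mul0r.
Qed.

Context (f_ge0 : forall X, 0 <= f X).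
Context (f_mono : set_monotone f) (f_sub : submodular f).
Context (OPT_tau : tau <= f OPT) (OPT_gt0 : (0 < #|OPT|)%N).
Context (sel_argmax : argmax_rule f tau sel).
Context (eps01 : 0 < eps <= 1) (alpha_gt0 : 0 < alpha) (tau_gt0 : 0 < tau).

Local Notation L := (ln (3 / eps)).

(** [expected_residual_step] is iterated with [lam = L / G] while the guess is at most [G]; the
    initial residual is at most [tau] since [f] is nonnegative. *)
Lemma expected_residual (G : R) (j t : nat) :
  (forall t, (t < j)%N -> guess eps alpha t <= G) -> 0 < G -> (t <= j)%N ->
  \sum_S run_law t S * residual f tau S <=
  (1 - (1 - expR (- (L * #|OPT|%:R / G))) / #|OPT|%:R) ^+ t * tau.
Proof.
move=> gG G0; have L1 := log_ge eps01.
set q := 1 - _; have q0 : 0 <= q.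
  rewrite /q subr_ge0 ler_pdivrMr ?ltr0n // mul1r.
  apply: le_trans (_ : 1 <= _); last by rewrite ler1n.
  by rewrite gerBl expR_ge0.
elim: t => [|t IH] tj.
  rewrite (bigD1 finset.set0) //= eqxx mul1r big1 ?addr0 => [|S /negPf ->].
    by rewrite expr0 mul1r gerBl /truncated le_min f_ge0 ltW.
  by rewrite mul0r.
rewrite sum_run_lawS exprS -mulrA.
apply: le_trans (_ : q * \sum_S run_law t S * residual f tau S <= _); last first.
  by rewrite ler_wpM2l // IH // ltnW.
rewrite mulr_sumr; apply: ler_sum => S _; rewrite mulrCA ler_wpM2l ?run_law_ge0 //.
rewrite /q mulrAC; apply: expected_residual_step => //.
- exact: geq_minl.
- by rewrite divr_ge0 //; lra.
- exact/sample_size_large/gG.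
Qed.

Lemma run_fails_le_half (j c : nat) (G : R) :
  (2 <= c)%N -> (c * #|OPT| <= j)%N -> L <= c%:R -> 0 < G -> L * G <= j.+1%:R ->
  (forall t, (t < j)%N -> guess eps alpha t <= G) ->
  \sum_(S | f S < (1 - eps) * tau) run_law j S <= 1 / 2.
Proof.
move=> c2 ckj Lc G0 LG gG; have L1 := log_ge eps01; have /andP[e0 _] := eps01.
have et0 : 0 < eps * tau by rewrite mulr_gt0.
have L1c : 27 / 25 <= L <= c%:R by rewrite L1 Lc.
have decay := residual_decay OPT_gt0 c2 ckj L1c G0 LG.
have := expected_residual gG G0 (leqnn j).
have eL : expR (- L) = eps / 3.
  by rewrite -lnV ?posrE ?divr_gt0 // lnK ?posrE ?invr_gt0 ?divr_gt0 // invf_div.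
rewrite eL -(ler_pM2r tau_gt0) in decay.
move=> /le_trans/(_ decay) h.
rewrite -(ler_pM2r et0); apply: le_trans (_ : \sum_S run_law j S * residual f tau S <= _).
  (* Markov's inequality: a set with [f S < (1 - eps) * tau] has residual above [eps * tau]. *)
  rewrite mulr_suml big_mkcond /=; apply: ler_sum => S _.
  case: ifP => fS; last by rewrite mulr_ge0 ?run_law_ge0 ?residual_ge0.
  rewrite ler_wpM2l ?run_law_ge0 // /residual /truncated lerBrDr -lerBrDl.
  by rewrite ge_min; apply/orP; left; lra.
by apply: le_trans h _; lra.
Qed.

End RunLaw.

(** * Random variables with finitely many values *)

Section FiniteValued.
Context {R : realType} {d : measure_display} {T : measurableType d} (P : probability T R).

(** This is [discrete_rv] for any finite codomain, as solutions and samples get combined into pairs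
    and tables. *)
Definition finite_rv (F : finType) (X : T -> F) := forall B : set F, measurable (X @^-1` B).

Lemma finite_rv_fibers (F : finType) (X : T -> F) :
  (forall x, measurable (X @^-1` [set x])) -> finite_rv X.
Proof.
move=> mX B; have -> : X @^-1` B = \bigcup_(x in B) (X @^-1` [set x]).
  by apply/seteqP; split => [w Bw|w [x Bx /= ->]] //=; exists (X w).
exact: fin_bigcup_measurable.
Qed.

Lemma finite_rv_comp2 (F1 F2 F3 : finType) (h : F1 -> F2 -> F3) (X1 : T -> F1) (X2 : T -> F2) :
  finite_rv X1 -> finite_rv X2 -> finite_rv (fun w => h (X1 w) (X2 w)).
Proof.
move=> m1 m2 B.
have mX : finite_rv (fun w => (X1 w, X2 w)).
  apply: finite_rv_fibers => -[x y].
  have -> : (fun w => (X1 w, X2 w)) @^-1` [set (x, y)] = X1 @^-1` [set x] `&` X2 @^-1` [set y].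
    by apply/seteqP; split => w /= [-> ->].
  exact: measurableI.
exact: (mX [set p | B (h p.1 p.2)]).
Qed.

Lemma finite_rv_ffun (I F : finType) (X : I -> T -> F) :
  (forall i, finite_rv (X i)) -> finite_rv (fun w => [ffun i => X i w]).
Proof.
move=> mX; apply: finite_rv_fibers => z.
have -> : (fun w => [ffun i => X i w]) @^-1` [set z] =
    \bigcap_(i in [set: I]) (X i @^-1` [set z i]).
  apply/seteqP; split => w /=; first by move=> <- i _; rewrite ffunE.
  by move=> h; apply/ffunP => i; rewrite ffunE; apply: h.
by apply: fin_bigcap_measurable => // i _; apply: mX.
Qed.

Lemma prob_finite_union (F : finType) (Q : pred F) (E : F -> set T) :
  (forall x, measurable (E x)) -> (forall x x' w, E x w -> E x' w -> x = x') ->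
  P [set w | exists2 x, Q x & E x w] = (\sum_(x | Q x) P (E x))%E.
Proof.
move=> mE dE; have -> : [set w | exists2 x, Q x & E x w] =
    \bigcup_(x in [set` [seq x <- enum F | Q x]]) E x.
  apply/seteqP; split => w /=.
    by move=> [x Qx Ex]; exists x; rewrite //= mem_filter Qx mem_enum.
  by move=> [x /=]; rewrite mem_filter => /andP[Qx _] Ex; exists x.
rewrite measure_fin_bigcup //; last by move=> x x' _ _ [w [Ex Ex']]; apply: dE Ex Ex'.
have uF : uniq [seq x <- enum F | Q x] by apply: filter_uniq; apply: enum_uniq.
by rewrite -fsbig_seq // big_filter big_enum_cond.
Qed.

End FiniteValued.

(** * Independence of the runs *)

Section JointLaw.
Context {R : realType} {U : finType}.
Context (eps alpha delta : R).
Context (sel : {set U} -> {set U} -> option U).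
Context {d : measure_display} {T : measurableType d} (P : probability T R).
Local Notation m := (num_runs delta).
Context (draw : nat -> 'I_m -> T -> {set U}).
Context (samples : random_samples P eps alpha draw).

Local Notation sol := (solution sel draw).
Local Notation law := (run_law eps alpha sel).

Lemma solution_measurable t i : finite_rv (sol t i).
Proof.
have [mdraw _ _] := samples; elim: t => [|t IH]; last first.
  exact: (finite_rv_comp2 (greedy_step sel) IH (mdraw t i)).
apply: finite_rv_fibers => S.
have [->|S0] := eqVneq S finset.set0.
  by rewrite (_ : _ @^-1` _ = setT) //; apply/seteqP; split.
rewrite (_ : _ @^-1` _ = set0) //; apply/seteqP; split => w //= E.
by rewrite -E eqxx in S0.
Qed.

Lemma draw_law t i A :
  P (draw t i @^-1` [set A]) = (uniform_mass (sample_size #|U| eps alpha t) A)%:E.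
Proof. by have [_ unif _] := samples; rewrite unif. Qed.

(* The events on draws of later iterations serve the induction on [t]. *)
Lemma joint_law t (z : 'I_m -> {set U}) (J : seq (nat * 'I_m)) (B : nat * 'I_m -> set {set U}) :
  uniq J -> (forall j, j \in J -> (t <= j.1)%N) ->
  P [set w | (forall i, sol t i w = z i) /\ (forall j, j \in J -> B j (draw j.1 j.2 w))] =
  ((\prod_i law t (z i))%:E * \prod_(j <- J) P (draw j.1 j.2 @^-1` B j))%E.
Proof.
have [mdraw unif indep] := samples.
elim: t z J B => [|t IH] z J B uJ tJ.
  rewrite -(indep J B uJ) /=.
  have [/forallP z0|] := boolP [forall i, z i == finset.set0].
    rewrite big1 => [|i _]; last by rewrite z0.
    rewrite mul1e; congr (P _); apply/seteqP; split => w /=; first by case.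
    by move=> h; split=> // i; rewrite (eqP (z0 i)).
  rewrite negb_forall => /existsP[i zi].
  rewrite (bigD1 i) //= (negPf zi) mul0r mul0e.
  rewrite (_ : [set w | _] = set0) ?measure0 //.
  apply/seteqP; split => w //= -[/(_ i) E _].
  by rewrite -E eqxx in zi.
(* The event at time [t.+1] is split over the tables [b] that record, for each run, the solution at
   time [t] and the sample drawn then. Fixing these samples adds the indices [(t, i)] to [J]. *)
pose J' := [seq (t, i) | i <- enum 'I_m] ++ J.
pose B' (b : {ffun 'I_m -> {set U} * {set U}}) (j : nat * 'I_m) :=
  if j.1 == t then [set (b j.2).2] else B j.
pose E (b : {ffun 'I_m -> {set U} * {set U}}) := [set w | (forall i, sol t i w = (b i).1) /\
                     (forall j, j \in J' -> B' b j (draw j.1 j.2 w))].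
have notJ i : (t, i) \notin J by apply/negP => /tJ /=; rewrite ltnn.
have BJ (b : {ffun 'I_m -> {set U} * {set U}}) j : j \in J -> B' b j = B j.
  by move=> /tJ tj; rewrite /B' gtn_eqF.
have uJ' : uniq J'.
  rewrite cat_uniq uJ andbT map_inj_uniq ?enum_uniq; last by move=> i i' [].
  apply/hasPn => -[t' i] /tJ /= tt'; apply/negP => /mapP[i' _ [E' _]].
  by rewrite E' ltnn in tt'.
have tJ' j : j \in J' -> (t <= j.1)%N.
  by rewrite mem_cat => /orP[/mapP[i _ ->] //|/tJ /ltnW].
have inJ' i : (t, i) \in J'.
  by rewrite mem_cat map_f ?mem_enum.
pose Q (b : {ffun 'I_m -> {set U} * {set U}}) := [forall i, greedy_step sel (b i).1 (b i).2 == z i].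
have -> : [set w | (forall i, sol t.+1 i w = z i) /\
    (forall j, j \in J -> B j (draw j.1 j.2 w))] = [set w | exists2 b, Q b & E b w].
  apply/seteqP; split => w /=.
    move=> [wz wJ]; exists [ffun i => (sol t i w, draw t i w)].
      by apply/forallP => i; rewrite ffunE /= -wz.
    split=> [i|j]; first by rewrite ffunE.
    rewrite mem_cat => /orP[/mapP[i _ ->]|jJ]; last by rewrite BJ //; apply: wJ.
    by rewrite /B' /= eqxx ffunE.
  move=> [b /forallP Qb [wb wJ]]; split => [i|j jJ].
    have /= := wJ _ (inJ' i); rewrite /B' /= eqxx => wi.
    by rewrite -(eqP (Qb i)) -wb -wi.
  by rewrite -(BJ b) //; apply: wJ; rewrite mem_cat jJ orbT.
rewrite (@prob_finite_union _ _ _ P _ Q E); first last.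
- move=> b b' w [wb wJ] [wb' wJ']; apply/ffunP => i.
  have := wJ _ (inJ' i); have := wJ' _ (inJ' i); rewrite /B' /= eqxx => E1 E2.
  by rewrite [LHS]surjective_pairing [RHS]surjective_pairing -wb -wb' -E1 -E2.
- move=> b; rewrite /E.
  rewrite (_ : [set w | _ /\ _] =
    \bigcap_(i in [set: 'I_m]) (sol t i @^-1` [set (b i).1]) `&`
    \bigcap_(j in [set` J']) (draw j.1 j.2 @^-1` B' b j)).
    apply: measurableI; first by apply: fin_bigcap_measurable => // i _; apply: solution_measurable.
    by apply: fin_bigcap_measurable => // j _; apply: mdraw.
  by apply/seteqP; split => w /= [h1 h2]; split => // i; [move=> _ | apply: (h1 i)].
have PE (b : {ffun 'I_m -> {set U} * {set U}}) : P (E b) =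
    ((\prod_i (law t (b i).1 *
       uniform_mass (sample_size #|U| eps alpha t) (b i).2))%:E *
    \prod_(j <- J) P (draw j.1 j.2 @^-1` B j))%E.
  rewrite /E IH // big_cat /= muleA; congr (_ * _)%E; last first.
    by rewrite [LHS]big_seq [RHS]big_seq; apply: eq_bigr => j jJ; rewrite BJ.
  rewrite big_map big_enum /= big_split /= EFinM; congr (_ * _)%E.
  rewrite -prodEFin; apply: eq_bigr => i _.
  by rewrite /B' /= eqxx draw_law.
rewrite (eq_bigr _ (fun b _ => PE b)).
rewrite -ge0_sume_distrl; last first.
  move=> b _; rewrite lee_fin prodr_ge0 // => i _.
  by rewrite mulr_ge0 ?run_law_ge0 ?uniform_mass_ge0.
congr (_ * _)%E; rewrite sumEFin; congr (_%:E) => /=.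
(* The product over the runs is expanded into a sum over tables; those not leading to [z] contribute
   0. *)
rewrite bigA_distr_bigA big_mkcond /=; apply: eq_bigr => b _.
rewrite /Q; case: forallP => [Qb|/forallP].
  by apply: eq_bigr => i _; rewrite Qb.
rewrite negb_forall => /existsP[i Qi].
by rewrite (bigD1 i) //= (negPf Qi) mul0r.
Qed.

(** The sum of [joint_law], without later draws, over the tables with values in [Q] factors into [m]
    equal sums. *)
Lemma all_runs_in t (Q : pred {set U}) :
  P [set w | forall i, Q (sol t i w)] = ((\sum_(S | Q S) law t S) ^+ m)%:E.
Proof.
have -> : [set w | forall i, Q (sol t i w)] =
    [set w | exists2 z : {ffun 'I_m -> {set U}}, [forall i, Q (z i)] &
      [set w | (forall i, sol t i w = z i) /\
        (forall j, j \in [::] -> setT (draw j.1 j.2 w))] w].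
  apply/seteqP; split => w /=.
    move=> wQ; exists [ffun i => sol t i w]; last by split=> // i; rewrite ffunE.
    by apply/forallP => i; rewrite ffunE.
  by move=> [z /forallP zQ [wz _]] i; rewrite wz.
rewrite prob_finite_union; first last.
- by move=> z z' w [wz _] [wz' _]; apply/ffunP => i; rewrite -wz -wz'.
- move=> z; rewrite (_ : [set w | _ /\ _] =
      \bigcap_(i in [set: 'I_m]) (sol t i @^-1` [set z i])).
    by apply: fin_bigcap_measurable => // i _; apply: solution_measurable.
  by apply/seteqP; split => w /= => [[h _] i _|h]; [|split=> // i]; apply: h.
rewrite (eq_bigr (fun z : {ffun 'I_m -> {set U}} => (\prod_i law t (z i))%:E)); last first.
  move=> z _; have := @joint_law t z [::] (fun=> setT) isT.
  by rewrite big_nil mule1; apply.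
rewrite sumEFin; congr (_%:E).
rewrite [X in _ = X ^+ _]big_mkcond /=; set x := \sum_S _.
have -> : x ^+ m = \prod_(i < m) x by rewrite prodr_const card_ord.
rewrite /x bigA_distr_bigA big_mkcond /=; apply: eq_bigr => z _.
case: forallP => [Qz|/forallP].
  by apply: eq_bigr => i _; rewrite Qz.
rewrite negb_forall => /existsP[i Qi].
by rewrite (bigD1 i) //= (negPf Qi) mul0r.
Qed.

End JointLaw.

(** * Number of queries *)
Section Queries.
Context {R : realType} (eps alpha : R).
Context (eps01 : 0 < eps <= 1) (alpha_gt0 : 0 < alpha).

Local Notation L := (ln (3 / eps)).
Local Notation y := (1 + alpha).
Local Notation g := (guess eps alpha).

(* A guess [g] is used in at most [L g - L g / y] iterations, and in one more
   for each change of guess; the term [y / (alpha * g t)] pays for the latter. *)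
Lemma sum_inv_guess_aux (t : nat) :
  \sum_(i < t) (g i)^-1 + y / (alpha * g t) <=
    1 / alpha + (L - 1) / y - L * alpha / y + L * alpha / y * (ln (g t) / ln y) +
    Num.min (L * alpha / y) (t.+1%:R / g t - L / y).
Proof.
have L1 := log_ge eps01; have y1 := base_gt1 alpha_gt0; have a0 := alpha_gt0.
have lny : 0 < ln y by rewrite ln_gt0.
have A0 : 0 <= L * alpha / y by rewrite divr_ge0 ?mulr_ge0 //; lra.
have AE : L * alpha / y = L - L / y by field; lra.
elim: t => [|t IH].
  rewrite big_ord0 add0r /= mulfV ?gt_eqF // mulr1 min_r; last first.
    rewrite -mulrBl; apply: le_trans (_ : 0 <= _).
      by rewrite pmulr_lle0 ?invr_gt0; lra.
    exact: A0.
  rewrite le_eqVlt; apply/orP; left; apply/eqP.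
  by field; rewrite !gt_eqF //; lra.
have g0 := guess_gt0 eps alpha_gt0 t.
rewrite big_ord_recr /=; case: ifP => [Lg|/negbT].
  (* At a change, [1 / g + y / (alpha * y * g) = y / (alpha * g)] absorbs the extra iteration. The
     logarithm grows by 1, which pays for the reset of the minimum. *)
  have -> : \sum_(i < t) (g i)^-1 + (g t)^-1 + y / (alpha * (y * g t)) =
      \sum_(i < t) (g i)^-1 + y / (alpha * g t).
    by field; rewrite !gt_eqF //; lra.
  have -> : ln (y * g t) / ln y = 1 + ln (g t) / ln y.
    rewrite lnM ?posrE //; last lra.
    by rewrite mulrDl mulfV ?gt_eqF.
  apply: le_trans IH _; rewrite mulrDr mulr1.
  have m1 : Num.min (L * alpha / y) (t.+1%:R / g t - L / y) <= L * alpha / y.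
    by rewrite ge_min lexx.
  have m2 : 0 <= Num.min (L * alpha / y) (t.+2%:R / (y * g t) - L / y).
    rewrite le_min A0 /= subr_ge0 ler_pdivlMr ?mulr_gt0 //; last lra.
    by rewrite mulrA divfK ?gt_eqF ?ltW //; lra.
  lra.
rewrite -leNgt => Lg.
(* Without a change the counter is still at most [L * g t], so the new minimum is its second
   argument, which has grown by exactly [1 / g t]. *)
have gt : t.+2%:R / g t <= L by rewrite ler_pdivrMr.
have m1 : Num.min (L * alpha / y) (t.+1%:R / g t - L / y) <= t.+1%:R / g t - L / y.
  by rewrite ge_min lexx orbT.
have -> : Num.min (L * alpha / y) (t.+2%:R / g t - L / y) = t.+2%:R / g t - L / y.
  by rewrite min_r // AE lerD2r.
have -> : t.+2%:R / g t = t.+1%:R / g t + (g t)^-1 by rewrite -[t.+2%:R]natr1 mulrDl mul1r.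
lra.
Qed.

Lemma sum_inv_guess (t : nat) :
  \sum_(i < t) (g i)^-1 <= 1 / alpha + L / y + L * alpha / y * (ln (g t) / ln y).
Proof.
have y1 := base_gt1 alpha_gt0; have a0 := alpha_gt0; have g0 := guess_gt0 eps alpha_gt0 t.
have h1 : 0 <= y / (alpha * g t) by rewrite divr_ge0 ?mulr_ge0 //; lra.
have h2 : Num.min (L * alpha / y) (t.+1%:R / g t - L / y) <= L * alpha / y.
  by rewrite ge_min lexx.
have h3 : (L - 1) / y <= L / y by rewrite ler_wpM2r ?invr_ge0 //; lra.
have := sum_inv_guess_aux t; lra.
Qed.

Lemma sample_size_le (n t : nat) :
  (sample_size n eps alpha t)%:R <= n%:R * L * (g t)^-1 + 1.
Proof.
have L1 := log_ge eps01; have g0 := guess_gt0 eps alpha_gt0 t.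
have x0 : 0 <= n%:R * L / g t by rewrite divr_ge0 ?mulr_ge0 //; lra.
have c0 : 0 <= Num.ceil (n%:R * L / g t) by rewrite ceil_ge0; lra.
apply: le_trans (_ : `|Num.ceil (n%:R * L / g t)|%N%:R <= _).
  by rewrite ler_nat geq_minr.
have -> : `|Num.ceil (n%:R * L / g t)|%N%:R = (Num.ceil (n%:R * L / g t))%:~R :> R.
  by rewrite -[in RHS](gez0_abs c0).
have := ceilB1_lt (n%:R * L / g t); rewrite intrB; lra.
Qed.

(** The part of the cost of a run, relative to [n * L ^ 2], that is free of [ln k]. The term [8 * y]
    pays for the evaluations outside the marginal gains and for rounding the sample sizes; the rest
    comes from [sum_inv_guess] and [g t <= 3 * y ^ 2 * k]. *)
Definition query_excess : R :=
  8 * y + 2 / alpha + 2 / y + 2 * alpha / y * (2 + ln 3 / ln y).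

Lemma query_excess_ge0 : 0 <= query_excess.
Proof.
have y1 := base_gt1 alpha_gt0; have a0 := alpha_gt0.
have lny : 0 < ln y by rewrite ln_gt0.
have l3 : 0 <= ln 3 :> R by rewrite ln_ge0 // ler1n.
have h1 : 0 <= 2 / alpha by rewrite divr_ge0 // ltW.
have h2 : 0 <= 2 / y by rewrite divr_ge0 //; lra.
have h3 : 0 <= 2 * alpha / y * (2 + ln 3 / ln y).
  by rewrite mulr_ge0 ?divr_ge0 ?addr_ge0 // ?divr_ge0 // ?ltW //; lra.
rewrite /query_excess; lra.
Qed.

Lemma iteration_cost (n k t : nat) : (0 < k <= n)%N -> t%:R <= 2 * y * L * k%:R ->
  t.+2%:R + \sum_(i < t) 2 * (sample_size n eps alpha i)%:R <=
  n%:R * L ^+ 2 * (query_excess + 2 * (alpha / y * (ln k%:R / ln y))).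
Proof.
move=> /andP[k0 kn] tk.
have L1 := log_ge eps01; have y1 := base_gt1 alpha_gt0; have a0 := alpha_gt0.
have kR : 1 <= k%:R :> R by rewrite ler1n.
have knR : k%:R <= n%:R :> R by rewrite ler_nat.
have lny : 0 < ln y by rewrite ln_gt0.
have yk1 : 1 <= y * k%:R by nra.
have yLk1 : 1 <= y * L * k%:R by nra.
have g0 := guess_gt0 eps alpha_gt0 t.
have gk : g t <= 3 * y ^+ 2 * k%:R.
  have [gy|gL] := guess_le_iter eps01 alpha_gt0 t; first by nra.
  have L0 : 0 < L by lra.
  rewrite -(ler_pM2l L0); apply: le_trans gL _.
  apply: le_trans (_ : y * (3 * y * L * k%:R) <= _); last by lra.
  by rewrite ler_pM2l; [rewrite -natr1; lra | lra].
have lng : ln (g t) <= ln 3 + 2 * ln y + ln k%:R.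
  apply: le_trans (_ : ln (3 * y ^+ 2 * k%:R) <= _).
    by rewrite ler_ln ?posrE // !mulr_gt0 ?exprn_gt0 //; lra.
  rewrite lnM ?posrE ?mulr_gt0 ?exprn_gt0 //; try lra.
  by rewrite lnM ?posrE ?exprn_gt0 ?lnXn //; lra.
have A0 : 0 <= L * alpha / y by rewrite divr_ge0 ?mulr_ge0 //; lra.
have S1 := sum_inv_guess t.
have lng' : ln (g t) / ln y <= ln 3 / ln y + 2 + ln k%:R / ln y.
  rewrite ler_pdivrMr //; apply: le_trans lng _.
  by rewrite !mulrDl !divfK ?gt_eqF.
have S2 : \sum_(i < t) (g i)^-1 <=
    L * (1 / alpha + 1 / y + alpha / y * (2 + ln 3 / ln y + ln k%:R / ln y)).
  apply: le_trans S1 _.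
  have : 1 / alpha <= L * (1 / alpha) by rewrite ler_peMl ?divr_ge0 //; lra.
  have := ler_wpM2l A0 lng'; lra.
have S3 : \sum_(i < t) 2 * (sample_size n eps alpha i)%:R <=
    2 * n%:R * L * \sum_(i < t) (g i)^-1 + 2 * t%:R :> R.
  rewrite mulr_sumr.
  have -> : 2 * t%:R = \sum_(i < t) 2 :> R by rewrite sumr_const card_ord mulr_natr.
  rewrite -big_split /=; apply: ler_sum => i _.
  by have := sample_size_le n i; lra.
apply: le_trans (lerD (lexx _) S3) _.
have nL0 : 0 <= 2 * n%:R * L by rewrite !mulr_ge0 //; lra.
have := ler_wpM2l nL0 S2 => S4.
have base : 3 * t%:R + 2 <= n%:R * L ^+ 2 * (8 * y) :> R.
  apply: le_trans (_ : 8 * (y * L * k%:R) <= _); first by lra.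
  have : y * L * k%:R <= y * L * n%:R by rewrite ler_wpM2l // mulr_ge0; lra.
  have : y * L * n%:R <= y * L * n%:R * L by rewrite ler_peMr // ?mulr_ge0 //; lra.
  lra.
have -> : t.+2%:R = t%:R + 2 :> R by rewrite -addn2 natrD.
by rewrite /query_excess; lra.
Qed.

Lemma ln2_ge : 1 / 2 <= ln 2 :> R.
Proof.
have h : 1 / 2 <= expR (- (1 / 2)) :> R.
  by apply: le_trans (expR_ge1Dx _); lra.
rewrite -ler_expR lnK ?posrE // -[1 / 2]opprK expRN -[leRHS]invrK.
by rewrite lef_pV2 ?posrE ?expR_gt0 ?invr_gt0 // -[leLHS]div1r.
Qed.

Lemma num_runs_ge (delta : R) : 0 < delta < 1 -> ln delta^-1 / ln 2 <= (num_runs delta)%:R.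
Proof.
move=> /andP[d0 d1]; have l2 := ln2_ge.
have x0 : 0 <= ln delta^-1 / ln 2.
  by rewrite divr_ge0 ?ln_ge0 //; [rewrite invf_ge1 // ltW | lra].
rewrite /num_runs; have c0 : 0 <= Num.ceil (ln delta^-1 / ln 2) by rewrite ceil_ge0; lra.
have -> : `|Num.ceil (ln delta^-1 / ln 2)|%N%:R = (Num.ceil (ln delta^-1 / ln 2))%:~R :> R.
  by rewrite -[in RHS](gez0_abs c0).
exact: ceil_ge.
Qed.

(** For [delta <= 1/2] the quotient by ln 2 is at least 1, so rounding up at most doubles it;
    [1/2 <= ln 2] costs another factor 2. *)
Lemma num_runs_le (delta : R) : 0 < delta -> delta <= 1 / 2 ->
  (num_runs delta)%:R <= 4 * ln delta^-1.
Proof.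
move=> d0 d2; have l2 := ln2_ge.
have ld : ln 2 <= ln delta^-1.
  by rewrite ler_ln ?posrE ?invr_gt0 // -[leLHS]invrK lef_pV2 ?posrE ?invr_gt0 // -[leRHS]div1r.
have x0 : 1 <= ln delta^-1 / ln 2 by rewrite ler_pdivlMr; lra.
rewrite /num_runs; have c0 : 0 <= Num.ceil (ln delta^-1 / ln 2) by rewrite ceil_ge0; lra.
have -> : `|Num.ceil (ln delta^-1 / ln 2)|%N%:R = (Num.ceil (ln delta^-1 / ln 2))%:~R :> R.
  by rewrite -[in RHS](gez0_abs c0).
have : ln delta^-1 / ln 2 <= 2 * ln delta^-1 by rewrite ler_pdivrMr; nra.
have := ceilB1_lt (ln delta^-1 / ln 2); rewrite intrB; lra.
Qed.

Lemma num_queries_le (delta : R) (n k t : nat) :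
  0 < delta -> delta <= 1 / 2 -> (0 < k <= n)%N -> t%:R <= 2 * y * L * k%:R ->
  (num_queries n eps alpha delta t)%:R <=
  8 * query_bound n k eps alpha delta +
  4 * query_excess * (n%:R * ln delta^-1 * L ^+ 2).
Proof.
move=> d0 d2 kn tk; have cost := iteration_cost kn tk.
have m4 := num_runs_le d0 d2.
rewrite /num_queries -mulnDr natrM natrD natr_sum.
under eq_bigr do rewrite natrM.
have X0 : 0 <= t.+2%:R + \sum_(i < t) 2 * (sample_size n eps alpha i)%:R :> R.
  by rewrite addr_ge0 // sumr_ge0 // => i _; rewrite mulr_ge0.
have ld : 0 <= ln delta^-1 by have : 0 <= (num_runs delta)%:R :> R by []; lra.
apply: le_trans (_ : (4 * ln delta^-1) * (n%:R * L ^+ 2 *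
  (query_excess + 2 * (alpha / y * (ln k%:R / ln y)))) <= _).
  by apply: ler_pM.
rewrite /query_bound le_eqVlt; apply/orP; left; apply/eqP.
by ring.
Qed.

End Queries.

(** * The output *)
Section Output.
Context {R : realType} {U : finType}.
Context (f : {set U} -> R) (tau eps alpha delta : R).
Context (sel : {set U} -> {set U} -> option U).
Context {d : measure_display} {T : measurableType d} (P : probability T R).
Local Notation m := (num_runs delta).
Context (draw : nat -> 'I_m -> T -> {set U}).

Local Notation sol := (solution sel draw).
Local Notation ok := (feasible f tau eps).
Local Notation halts := (halts_at f tau eps sel draw).
Local Notation output := (stoch_greedy_c f tau eps alpha sel draw).

Lemma halts_at_unique w t t' : halts t w -> halts t' w -> t = t'.
Proof.
move=> [lt nt] [lt' nt']; have [h|h|//] := ltngtP t t'.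
- by case: nt; apply: lt'.
- by case: nt'; apply: lt.
Qed.

Lemma halts_before w t : ~ loop_test f tau eps sel draw t w ->
  exists2 t', (t' <= t)%N & halts t' w.
Proof.
move=> nt; have ex : exists t, `[< ~ loop_test f tau eps sel draw t w >].
  by exists t; apply/asboolP.
have [t' /asboolP nt' min_t'] := ex_minnP ex.
exists t'; first by apply: min_t'; apply/asboolP.
split=> // s st'; apply: contrapT => ns.
by have := min_t' s (asboolT ns); rewrite leqNgt st'.
Qed.

Lemma halts_output w t : halts t w -> exists S q, output w S q.
Proof.
move=> ht; have [i oki] : exists i, ok (sol t i w).
  by case: ht => _; rewrite /loop_test => /existsNP[i /contrapT]; exists i.
have [i' oki' min_i'] := @arg_minnP _ i (fun i => (1 - eps) * tau <= f (sol t i w))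
  (fun i => #|sol t i w|) oki.
by exists (sol t i' w), (num_queries #|U| eps alpha delta t), t, i'; split.
Qed.

Lemma card_solution_le t i w : (#|sol t i w| <= t)%N.
Proof.
elim: t => [|t IH] /=; first by rewrite cards0.
case: (sel _ _) => [u|]; last exact: leqW.
by rewrite cardsU1 -add1n leq_add // leq_b1.
Qed.

Context (samples : random_samples P eps alpha draw).

Lemma solutions_measurable t (B : set {ffun 'I_m -> {set U}}) :
  measurable [set w | B [ffun i => sol t i w]].
Proof.
have mZ : finite_rv (fun w => [ffun i => sol t i w]).
  by apply: finite_rv_ffun => i; apply: (solution_measurable sel samples t i).
exact: (mZ B).
Qed.

Lemma loop_test_measurable t : measurable [set w | loop_test f tau eps sel draw t w].
Proof.
have := solutions_measurable t [set z | forall i, ~ ok (z i)].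
congr measurable; apply/seteqP; split => w /= h i; have := h i; rewrite ffunE //.
Qed.

Lemma halts_measurable t : measurable [set w | halts t w].
Proof.
have -> : [set w | halts t w] =
    \bigcap_(s in `I_t) [set w | loop_test f tau eps sel draw s w] `&`
    ~` [set w | loop_test f tau eps sel draw t w].
  by apply/seteqP; split => w [h1 h2]; split.
apply: measurableI; last by apply: measurableC; apply: loop_test_measurable.
by apply: bigcap_measurableType => s _; apply: loop_test_measurable.
Qed.

(** Once the loop halts at [t], the condition depends only on the finite table of solutions at time
    [t], so the event is a countable union of measurable ones. *)
Lemma output_event_measurable (Phi : {set U} -> nat -> Prop) :
  measurable [set w | (exists S q, output w S q) /\ forall S q, output w S q -> Phi S q].
Proof.
pose good t (z : {ffun 'I_m -> {set U}}) := forall i, ok (z i) ->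
  (forall j, ok (z j) -> (#|z i| <= #|z j|)%N) -> Phi (z i) (num_queries #|U| eps alpha delta t).
have -> : [set w | (exists S q, output w S q) /\ forall S q, output w S q -> Phi S q] =
    \bigcup_t ([set w | halts t w] `&` [set w | good t [ffun i => sol t i w]]).
  apply/seteqP; split => w /=.
    move=> [[S [q [t [i [ht _ _ _ _]]]]] all]; exists t => //; split=> //= i' oki' min_i'.
    apply: all; exists t, i'; rewrite ffunE in oki' min_i' *; split => // j okj.
    by have := min_i' j; rewrite ffunE; apply.
  move=> [t _ [ht gt]]; split; first exact: halts_output ht.
  move=> S q [t' [i [ht' -> oki min_i ->]]].
  rewrite -(halts_at_unique ht ht') in oki min_i *.
  have := gt i; rewrite ffunE; apply => // j; rewrite ffunE; exact: min_i.
apply: bigcupT_measurable => t; apply: measurableI; first exact: halts_measurable.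
exact: solutions_measurable.
Qed.

End Output.

(** * Failure probability of all runs and choice of the constants *)

Lemma half_pow_num_runs {R : realType} (delta : R) : 0 < delta < 1 ->
  (1 / 2) ^+ num_runs delta <= delta.
Proof.
move=> d01; have /andP[d0 d1] := d01; have l2 := @ln2_ge R.
have := num_runs_ge d01; rewrite ler_pdivrMr; last lra.
move=> h; have -> : (1 / 2) ^+ num_runs delta = expR (- ((num_runs delta)%:R * ln 2)) :> R.
  by rewrite expRN expRM_natl lnK ?posrE // div1r exprVn.
rewrite -[leRHS](@lnK R) ?posrE // ler_expR.
by rewrite lnV ?posrE // in h; lra.
Qed.

Unset Implicit Arguments.

(** The constant [C] is absolute but serves only for [#|OPT|] large in terms of [alpha]; [D] depends
    on [alpha] and serves from 2 on, as the logarithm vanishes at 1. The condition [delta <= 1/2]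
    keeps ln(1/delta) away from 0, since at least one run is always made. *)
Theorem theorem3 (R : realType) :
  exists C : R, forall alpha : R, 0 < alpha ->
  exists (k0 : nat) (D : R),
  forall (U : finType) (f : {set U} -> R) (tau : R) (OPT : {set U})
    (eps delta : R),
  (forall X, 0 <= f X) -> set_monotone f -> submodular f ->
  is_opt f tau OPT ->
  0 < eps <= 1 -> 0 < delta < 1 ->
  forall (d : measure_display) (T : measurableType d) (P : probability T R)
    (draw : nat -> 'I_(num_runs delta) -> T -> {set U})
    (sel : {set U} -> {set U} -> option U),
  random_samples P eps alpha draw ->
  argmax_rule f tau sel ->
  ((1 - delta)%:E <= P [set w |
     ((exists S q, stoch_greedy_c f tau eps alpha sel draw w S q) /\
      forall S q, stoch_greedy_c f tau eps alpha sel draw w S q ->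
        [/\ (1 - eps) * tau <= f S,
            #|S|%:R <= (1 + alpha) * (Num.ceil (ln (3 / eps)))%:~R * #|OPT|%:R,
            (delta <= 1 / 2 -> (k0 <= #|OPT|)%N ->
               q%:R <= C * query_bound #|U| #|OPT| eps alpha delta) &
            (delta <= 1 / 2 -> (2 <= #|OPT|)%N ->
               q%:R <= D * query_bound #|U| #|OPT| eps alpha delta)])%R])%E.
Proof.
exists 9 => alpha a0.
have y1 := base_gt1 a0; have lny : 0 < ln (1 + alpha) by rewrite ln_gt0.
have l2 := @ln2_ge R.
pose K : R := 4 * query_excess alpha * ((1 + alpha) * ln (1 + alpha) / alpha).
have K0 : 0 <= K.
  by rewrite /K !mulr_ge0 ?query_excess_ge0 ?invr_ge0 //; lra.
(* The excess is [K / ln k] times the query bound. From [k0] on, [ln k >= K] makes this factor at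
   most 1, whence [9 = 8 + 1]; for [k >= 2] it is at most [K / ln 2]. *)
exists (Num.truncn (expR K)).+2, (8 + K / ln 2).
move=> U f tau OPT eps delta f_ge0 f_mono f_sub [OPT_tau _] eps01 delta01.
move=> d T P draw sel samples sel_argmax.
have /andP[d0 d1] := delta01; have /andP[e0 e1] := eps01.
have L1 := log_ge eps01; have [Lc c2] := log_ceil eps01.
set c := `|_|%N in Lc c2.
have cE : (Num.ceil (ln (3 / eps)))%:~R = c%:R :> R.
  have c0 : 0 <= Num.ceil (ln (3 / eps)) by rewrite ceil_ge0; lra.
  by rewrite /c -[in LHS](gez0_abs c0).
have cL : c%:R <= 2 * ln (3 / eps).
  by rewrite -cE; have := ceilB1_lt (ln (3 / eps)); rewrite intrB; lra.
set k := #|OPT|.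
set event := [set w | _].
have m_event : measurable event by apply: (output_event_measurable f tau sel samples).
have excess n : (2 <= k)%N -> delta <= 1 / 2 ->
    4 * query_excess alpha * (n%:R * ln delta^-1 * ln (3 / eps) ^+ 2) =
    K / ln k%:R * query_bound n k eps alpha delta.
  move=> k2 _; have lnk : 0 < ln k%:R :> R by rewrite ln_gt0 // ltr1n.
  by rewrite /K /query_bound; field; rewrite !gt_eqF //; lra.
(* If some run is feasible at time [j], all claims hold deterministically: the loop halts at some
   [t <= j], which bounds both the output and the queries. *)
have in_event j w : j%:R <= (1 + alpha) * c%:R * k%:R ->
    ~ loop_test f tau eps sel draw j w -> event w.
  move=> jk nj; have [t tj ht] := halts_before nj.
  have tk : t%:R <= (1 + alpha) * c%:R * k%:R by apply: le_trans jk; rewrite ler_nat.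
  split; first exact: halts_output ht.
  move=> S q [t' [i [ht' -> oki _ ->]]].
  rewrite -(halts_at_unique ht ht') in oki *.
  have queries : delta <= 1 / 2 -> (2 <= k)%N ->
      0 <= query_bound #|U| k eps alpha delta /\
      (num_queries #|U| eps alpha delta t)%:R <=
        (8 + K / ln k%:R) * query_bound #|U| k eps alpha delta.
    move=> d2 k2; have kU : (0 < k <= #|U|)%N by rewrite (ltnW k2) max_card.
    have lnk : 0 < ln k%:R :> R by rewrite ln_gt0 // ltr1n.
    have ld : 0 <= ln delta^-1 by rewrite ln_ge0 // invf_ge1 // ltW.
    split; first by rewrite /query_bound !mulr_ge0 ?invr_ge0 ?exprn_ge0 //; lra.
    rewrite mulrDl -excess //; apply: num_queries_le => //.
    apply: le_trans tk _.
    have : 0 <= (1 + alpha) * k%:R by rewrite mulr_ge0 //; lra.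
    by move=> yk0; have := ler_wpM2l yk0 cL; lra.
  split=> //.
  - rewrite cE; apply: le_trans tk; rewrite ler_nat; exact: card_solution_le.
  - move=> d2 k0; have k2 : (2 <= k)%N by apply: leq_trans k0.
    have [QB0 Q] := queries d2 k2; apply: le_trans Q _; rewrite ler_wpM2r //.
    have lnk : 0 < ln k%:R :> R by rewrite ln_gt0 // ltr1n.
    suff : K / ln k%:R <= 1 by lra.
    rewrite ler_pdivrMr // mul1r -ler_expR lnK ?posrE ?ltr0n; last by rewrite (ltnW k2).
    apply: le_trans (ltW (truncnS_gt _)) _; rewrite ler_nat; exact: ltnW.
  - move=> d2 k2; have [QB0 Q] := queries d2 k2; apply: le_trans Q _; rewrite ler_wpM2r //.
    rewrite lerD2l ler_wpM2l // lef_pV2 ?posrE ?ln_gt0 ?ltr1n //.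
    by rewrite ler_ln ?posrE ?ltr0n ?ler_nat // (ltnW k2).
(* A feasible empty set stops the loop at once; this covers [tau <= 0] and an empty [OPT]. *)
have trivial_case : (1 - eps) * tau <= f finset.set0 -> ((1 - delta)%:E <= P event)%E.
  move=> ok0; have -> : event = setT.
    apply/seteqP; split=> // w _; apply: (in_event 0%N); first by rewrite !mulr_ge0 //; lra.
    have m0 : (0 < num_runs delta)%N.
      rewrite -(ltr0n R); apply: lt_le_trans (num_runs_ge delta01).
      by rewrite divr_gt0 ?ln_gt0 ?invf_gt1 //; lra.
    by move=> /(_ (Ordinal m0)); apply.
  by rewrite probability_setT lee_fin; lra.
have [tau0|tau0] := leP tau 0.
  by apply: trivial_case; apply: le_trans (f_ge0 _); rewrite mulr_ge0_le0 //; lra.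
have [k0|k0] := posnP k.
  apply: trivial_case; have OPT0 : OPT = finset.set0 by apply/cards0_eq.
  by rewrite -OPT0; apply: le_trans OPT_tau; nra.
have [j [G [ckj jk G0 LG gG]]] := horizon eps01 a0 k0 Lc.
pose bad (S : {set U}) := f S < (1 - eps) * tau.
have m_bad : measurable [set w | forall i, bad (solution sel draw j i w)].
  have := solutions_measurable sel samples j [set z | forall i, bad (z i)].
  by congr measurable; apply/seteqP; split => w /= h i; have := h i; rewrite ffunE.
have fails := run_fails_le_half f_ge0 f_mono f_sub OPT_tau k0 sel_argmax eps01 a0 tau0
  c2 ckj Lc G0 LG gG.
have half0 : 0 <= \sum_(S | bad S) run_law eps alpha sel j S.
  by apply: sumr_ge0 => S _; apply: run_law_ge0.
apply: le_trans (_ : P (~` [set w | forall i, bad (solution sel draw j i w)]) <= _)%E; last first.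
  apply: le_measure; rewrite ?inE //; first exact: measurableC.
  move=> w nb; apply: (in_event j) => // test; apply: nb => i.
  by rewrite /bad ltNge; apply/negP/test.
rewrite probability_setC // (all_runs_in sel samples j bad) -EFinB lee_fin lerD2l lerN2.
apply: le_trans (half_pow_num_runs delta01).
by rewrite lerXn2r ?nnegrE //; lra.
Qed.
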